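(* Let $n\ge 2$ and let $A\in\mathbb{R}^{n\times n}$ be a symmetric irreducible adjacency matrix. Let $\rho$ denote the Perron value of $A$ and let $u$ be the Perron vector. Then the condition number $\kappa(u)$ of $u$ satisfies $$\kappa(u)\ge\frac{n-1}{n\rho}.$$
   Context: An adjacency matrix here is that of a connected simple undirected graph with positive edge weights: $A=[a_{ij}]$ is real, symmetric, entrywise nonnegative, has zero diagonal, and is irreducible. The Perron value $\rho$ is the spectral radius of $A$ (a simple positive eigenvalue), and the Perron vector $u$ is the unique associated eigenvector of unit Euclidean norm with all entries positive. For a normal matrix $M\in\mathbb{C}^{n\times n}$ with spectrum $\Lambda(M)$ and a unit eigenvector $x$ associated with a simple eigenvalue $\lambda$, the condition number of $x$ (i.e., of the one-dimensional invariant subspace spanned by $x$) is $$\kappa(x)=\frac{1}{\displaystyle\min_{\gamma\in\Lambda(M),\,\gamma\neq\lambda}|\lambda-\gamma|}.$$ Here it is applied with $M=A$, $\lambda=\rho$, $x=u$. *)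

(* Defs.v *)
From HB Require Import structures.
From mathcomp Require Import all_boot all_order all_algebra all_fingroup.
From mathcomp Require Import all_classical all_reals.
From mathcomp Require Import complex.
Set Implicit Arguments.
Unset Strict Implicit.
Unset Printing Implicit Defensive.
Import Order.TTheory GRing.Theory Num.Theory.
Local Open Scope classical_set_scope.
Local Open Scope ring_scope.

(* Some simultaneous permutation of the rows and columns makes A block upper
   triangular, with square diagonal blocks of sizes k and n - k. *)
Definition reducible_mx (R : realType) (n : nat) (A : 'M[R]_n) : Prop :=
  exists (s : 'S_n) (k : nat), (0 < k < n)%N /\
    forall i j : 'I_n, (j < k <= i)%N -> row_perm s (col_perm s A) i j = 0.

Definition irreducible_mx (R : realType) (n : nat) (A : 'M[R]_n) : Prop :=
  ~ reducible_mx A.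

Record adjacency_mx (R : realType) (n : nat) (A : 'M[R]_n) : Prop :=
  AdjacencyMx {
    adjacency_sym : A^T = A;
    adjacency_ge0 : forall i j, 0 <= A i j;
    adjacency_diag : forall i, A i i = 0;
    adjacency_irr : irreducible_mx A }.

Definition complex_mx (R : realType) (m n : nat) (A : 'M[R]_(m, n)) :
    'M[R[i]]_(m, n) :=
  map_mx (real_complex R) A.

Definition cmod (R : realType) (z : R[i]) : R := complex.Re `|z|.

Definition spectrum (R : realType) (n : nat) (M : 'M[R[i]]_n) : set R[i] :=
  [set z | eigenvalue M z].

(* The spectrum is finite, so for n > 0 this supremum is a maximum. *)
Definition spectral_radius (R : realType) (n : nat) (M : 'M[R[i]]_n) : R :=
  sup [set cmod z | z in spectrum M].

Definition perron_value (R : realType) (n : nat) (A : 'M[R]_n) : R :=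
  spectral_radius (complex_mx A).

(* The norm `|u| of MathComp-Analysis on matrices is the sup norm. *)
Definition euclidean_norm (R : realType) (n : nat) (u : 'cV[R]_n) : R :=
  Num.sqrt (\sum_(i < n) u i 0 ^+ 2).

Definition perron_vector (R : realType) (n : nat) (A : 'M[R]_n) (u : 'cV[R]_n) :
    Prop :=
  [/\ A *m u = perron_value A *: u, euclidean_norm u = 1
    & forall i, 0 < u i 0].

(* The eigenvalue to which an eigenvector x of M belongs; it is unique because
   x != 0.  Default value 0 if x is not an eigenvector. *)
Definition eigenvalue_of (R : realType) (n : nat) (M : 'M[R[i]]_n)
    (x : 'cV[R[i]]_n) : R[i] :=
  xget 0 [set z | M *m x = z *: x].

(* The infimum ranges over a finite set, hence is a minimum whenever M has an
   eigenvalue other than z. *)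
Definition eigenvalue_gap (R : realType) (n : nat) (M : 'M[R[i]]_n)
    (z : R[i]) : R :=
  inf [set cmod (z - g) | g in [set g | spectrum M g /\ g <> z]].

(* Meaningful for M normal and x a unit eigenvector of M belonging to a simple
   eigenvalue. *)
Definition eigenvector_cond (R : realType) (n : nat) (M : 'M[R[i]]_n)
    (x : 'cV[R[i]]_n) : R :=
  (eigenvalue_gap M (eigenvalue_of M x))^-1.

(* Main.v *)
(* A is unitarily diagonalisable with real eigenvalues, which sum to tr A = 0.
   By irreducibility rho occurs once among them, so the other n - 1 sum to -rho
   and one of them, say l, is at least their mean -rho/(n - 1).  Hence the gap
   at rho is at most rho - l <= n rho/(n - 1). *)
Require Import Defs.
From HB Require Import structures.
From mathcomp Require Import all_boot all_order all_algebra all_fingroup.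
From mathcomp Require Import all_classical all_reals.
From mathcomp Require Import complex.
From mathcomp Require Import ring.
Set Implicit Arguments.
Unset Strict Implicit.
Unset Printing Implicit Defensive.
Import Order.TTheory GRing.Theory Num.Theory.
Local Open Scope ring_scope.
Local Open Scope complex_scope.

(** Listing [S] before its complement gives a permutation that makes [A] block triangular with
    [k = #|S|]. A point [x] in [S] and a point [y] outside make both diagonal blocks nonempty. *)
Lemma irreducible_mx_block (R : realType) n (A : 'M[R]_n) (S : {set 'I_n}) :
  irreducible_mx A -> (forall i j, i \notin S -> j \in S -> A i j = 0) ->
  forall x y, x \in S -> y \in S.
Proof.
move=> irrA A0 x y xS; apply: contra_notT irrA => yS.
have /tuple_permP[s defs] : perm_eq (enum S ++ enum (~: S)) (ord_tuple n).
  apply: uniq_perm; rewrite ?cat_uniq ?val_ord_tuple ?enum_uniq //.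
    rewrite andbT /=; apply/hasPn => z.
    by rewrite !mem_enum inE.
  by move=> z; rewrite mem_cat !mem_enum inE orbN.
have nth_s (i : 'I_n) : nth x (enum S ++ enum (~: S)) i = s i.
  by rewrite defs -[in LHS](tnth_nth x) tnth_mktuple tnth_ord_tuple.
have cardS : (#|S| + #|~: S|)%N = n by rewrite cardsC card_ord.
have memS (i : 'I_n) : (s i \in S) = (i < #|S|)%N.
  rewrite -nth_s nth_cat -cardE; case: ltnP => [iS|Si].
    by rewrite -mem_enum mem_nth // -cardE.
  apply/negbTE; rewrite -finset.in_setC -mem_enum mem_nth // -cardE.
  by rewrite -(ltn_add2l #|S|) cardS subnKC.
exists s, #|S|; split.
  rewrite -[X in (_ < _ < X)%N]cardS -[X in (X < _ + _)%N]addn0 ltn_add2l.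
  by apply/andP; split; apply/card_gt0P; [exists x | exists y; rewrite inE].
move=> i j /andP[jS Si]; rewrite !mxE; apply: A0; rewrite memS //.
by rewrite -leqNgt.
Qed.

(** The support of a nonnegative solution of [A w = r w] satisfies the hypothesis of
    [irreducible_mx_block], so it is empty or everything. This is applied to [w = v - t u] with [t]
    chosen to create a zero entry. *)
Lemma irreducible_eigenvector (R : realType) n (A : 'M[R]_n) (r : R)
    (u v : 'cV[R]_n) :
  irreducible_mx A -> (forall i j, 0 <= A i j) ->
  A *m u = r *: u -> (forall i, 0 < u i 0) -> A *m v = r *: v ->
  exists t, v = t *: u.
Proof.
move=> irrA A_ge0 Au u_gt0 Av.
case: n => [|n] in A u v irrA A_ge0 Au u_gt0 Av *.
  by exists 0; rewrite [v]flatmx0 [RHS]flatmx0.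
(* The least ratio is the largest [t] with [v - t u >= 0]; entry [k] of the difference is then
   zero. *)
have [k _ kmin] := arg_minP (fun i => v i 0 / u i 0) (isT : predT (ord0 : 'I_n.+1)).
set t := v k 0 / u k 0 in kmin; exists t; apply/eqP; rewrite -subr_eq0; apply/eqP.
(* w >= 0 vanishes at k, so irreducibility forces w = 0. *)
set w := v - t *: u.
have w_ge0 i : 0 <= w i 0.
  by rewrite !mxE subr_ge0 -ler_pdivlMr // kmin.
have wk : w k 0 = 0 by rewrite !mxE /t divfK ?subrr // gt_eqF.
have Aw : A *m w = r *: w.
  by rewrite mulmxBr -scalemxAr Au Av scalerBr !scalerA mulrC.
apply/colP => i; rewrite [RHS]mxE; apply: contra_eq wk => wi.
suff: k \in [set i | w i 0 != 0] by rewrite inE.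
apply: (irreducible_mx_block irrA _ (x := i)); last by rewrite inE.
move=> {wi}i j; rewrite !inE negbK => /eqP wi wj.
(* At a zero [i] of [w], row [i] of [A w = r w] is a vanishing sum of nonnegative terms, so each
   term is zero. *)
have /psumr_eq0P/(_ j isT)/eqP : \sum_j A i j * w j 0 = 0.
  by have /colP/(_ i) := Aw; rewrite mxE => ->; rewrite mxE wi mulr0.
rewrite mulf_eq0 (negbTE wj) orbF => H; apply/eqP/H => l _.
exact: mulr_ge0.
Qed.

(** As [A] and [r] are real, the real and imaginary parts of [v] satisfy the same equation and are
    real multiples of [u]. *)
Lemma complex_irreducible_eigenvector (R : realType) n (A : 'M[R]_n) (r : R)
    (u : 'cV[R]_n) (v : 'cV[R[i]]_n) :
  irreducible_mx A -> (forall i j, 0 <= A i j) ->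
  A *m u = r *: u -> (forall i, 0 < u i 0) -> complex_mx A *m v = r%:C *: v ->
  exists t, v = t *: complex_mx u.
Proof.
move=> irrA A_ge0 Au u_gt0 Av.
have ReIm i : \sum_j A i j * complex.Re (v j 0) = r * complex.Re (v i 0) /\
              \sum_j A i j * complex.Im (v j 0) = r * complex.Im (v i 0).
  have /colP/(_ i) := Av; rewrite !mxE => Avi.
  have ReM (x : R) z : complex.Re (x%:C * z) = x * complex.Re z.
    by case: z => a b /=; rewrite mul0r subr0.
  have ImM (x : R) z : complex.Im (x%:C * z) = x * complex.Im z.
    by case: z => a b /=; rewrite mul0r addr0.
  split; [rewrite -ReM -Avi | rewrite -ImM -Avi].
    rewrite (big_morph (@complex.Re R) (id1 := 0) (op1 := +%R)) //;
      last by case=> ? ? [].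
    by apply: eq_bigr => j _; rewrite mxE ReM.
  rewrite (big_morph (@complex.Im R) (id1 := 0) (op1 := +%R)) //;
      last by case=> ? ? [].
  by apply: eq_bigr => j _; rewrite mxE ImM.
have [|a va] := @irreducible_eigenvector _ _ A r u (map_mx (@complex.Re R) v)
  irrA A_ge0 Au u_gt0.
  apply/colP => i; rewrite !mxE; under eq_bigr do rewrite mxE.
  by case: (ReIm i).
have [|b vb] := @irreducible_eigenvector _ _ A r u (map_mx (@complex.Im R) v)
  irrA A_ge0 Au u_gt0.
  apply/colP => i; rewrite !mxE; under eq_bigr do rewrite mxE.
  by case: (ReIm i).
exists (a +i* b); apply/colP => i.
move/colP/(_ i): va; move/colP/(_ i): vb; rewrite !mxE.
case: (v i 0) => x y /= -> ->.
by apply/eqP; rewrite eq_complex /= !mulr0 subr0 add0r !eqxx.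
Qed.

(** Over [R[i]] the matrix is Hermitian, so the spectral theorem applies. The diagonal [d] is kept
    over [R], where eigenvalues can be compared. *)
Lemma symmetric_mx_diag (R : realType) n (A : 'M[R]_n) : A^T = A ->
  exists P : 'M[R[i]]_n, exists2 d : 'rV[R]_n,
    P \in unitmx & complex_mx A = invmx P *m diag_mx (complex_mx d) *m P.
Proof.
move=> symA.
have herm : complex_mx A \is hermsymmx.
  apply: realsym_hermsym.
    by apply/is_hermitianmxP; rewrite expr0 scale1r map_mx_id // /complex_mx map_trmx symA.
  by apply/mxOverP => i j; rewrite mxE; apply/complex_realP; exists (A i j).
have /mxOverP dR := hermitian_spectral_diag_real herm.
exists (spectralmx (complex_mx A)).
exists (map_mx (@complex.Re R) (spectral_diag (complex_mx A))).
  exact: spectral_unit.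
have -> : complex_mx (map_mx (@complex.Re R) (spectral_diag (complex_mx A))) =
    spectral_diag (complex_mx A) by apply/rowP => j; rewrite !mxE RRe_real.
exact/orthomx_spectralP/hermitian_normalmx.
Qed.

(** [eigenvalue] refers to row vectors, so the rows of [P] serve as eigenvectors. *)
Lemma spectrum_diag (R : realType) n (M P : 'M[R[i]]_n) (D : 'rV[R[i]]_n) :
  P \in unitmx -> M = invmx P *m diag_mx D *m P ->
  forall z, spectrum M z <-> exists j, z = D 0 j.
Proof.
move=> uP defM z; split=> [/eigenvalueP[v vM v0]|[j ->]].
  set w := v *m invmx P.
  have w0 : w != 0.
    by apply: contra v0 => /eqP w0; rewrite -[v](mulmxKV uP) -/w w0 mul0mx.
  have wD : w *m diag_mx D = z *: w.
    by rewrite scalemxAl -vM defM !mulmxA mulmxK.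
  clearbody w; have [j wj] := rV0Pn _ w0.
  by exists j; move/rowP/(_ j): wD; rewrite mul_mx_diag !mxE mulrC => /(mulIf wj).
apply/eigenvalueP; exists (row j P).
  rewrite defM -!row_mul !mulmxA mulmxV // mul1mx row_mul row_diag_mx.
  by rewrite -scalemxAl -rowE.
apply/eqP => rj0.
have : row j P *m invmx P = 0 by rewrite rj0 mul0mx.
rewrite -row_mul mulmxV // => /rowP/(_ j); rewrite !mxE eqxx.
by move/eqP; rewrite oner_eq0.
Qed.

Lemma cmod_real (R : realType) (x : R) : cmod x%:C = `|x|.
Proof. by rewrite /cmod normc_def /= expr0n addr0 sqrtr_sqr. Qed.

(** By symmetry of [A], each row of [P] belonging to [r] is, transposed, a multiple of [u]. Two such
    rows would be proportional, against the invertibility of [P]. *)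
Lemma perron_value_simple (R : realType) n (A : 'M[R]_n) (r : R) (u : 'cV[R]_n)
    (P : 'M[R[i]]_n) (d : 'rV[R]_n) :
  irreducible_mx A -> (forall i j, 0 <= A i j) -> A^T = A ->
  A *m u = r *: u -> (forall i, 0 < u i 0) ->
  P \in unitmx -> complex_mx A = invmx P *m diag_mx (complex_mx d) *m P ->
  forall i j, d 0 i = r -> d 0 j = r -> i = j.
Proof.
move=> irrA A_ge0 symA Au u_gt0 uP defA.
have rowP_u k : d 0 k = r -> exists2 t, t != 0 & row k P = t *: (complex_mx u)^T.
  move=> dk; have [|t tu] := @complex_irreducible_eigenvector _ _ A r u (row k P)^T
    irrA A_ge0 Au u_gt0.
    apply: trmx_inj; rewrite trmx_mul trmxK linearZ /= trmxK.
    rewrite /complex_mx map_trmx symA -/(complex_mx A) defA -row_mul !mulmxA mulmxV //.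
    by rewrite mul1mx row_mul row_diag_mx -scalemxAl -rowE mxE dk.
  have {}tu : row k P = t *: (complex_mx u)^T by rewrite -[LHS]trmxK tu linearZ.
  exists t => //; apply: contraTneq isT => t0.
  have : row k (P *m invmx P) = 0 by rewrite row_mul tu t0 scale0r mul0mx.
  by rewrite mulmxV // => /rowP/(_ k)/eqP; rewrite !mxE eqxx oner_eq0.
move=> i j /rowP_u[s s0 rs] /rowP_u[t t0 rt]; apply: contraTeq isT => ij.
have : row i (P *m invmx P) = (s / t) *: row j (P *m invmx P).
  by rewrite !row_mul rs rt scalemxAl scalerA divfK.
rewrite mulmxV // => /rowP/(_ i)/eqP.
by rewrite !mxE eqxx [j == i]eq_sym (negbTE ij) mulr0 oner_eq0.
Qed.

Lemma real_eigenvalue_le_perron (R : realType) n (A : 'M[R]_n)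
    (P : 'M[R[i]]_n) (d : 'rV[R]_n) :
  P \in unitmx -> complex_mx A = invmx P *m diag_mx (complex_mx d) *m P ->
  forall j, d 0 j <= perron_value A.
Proof.
move=> uP defA j; rewrite (le_trans (ler_norm _)) // -cmod_real.
apply: ub_le_sup; last first.
  by exists (d 0 j)%:C => //; apply/(spectrum_diag uP defA); exists j; rewrite mxE.
(* [sup] dominates its set only if the set is bounded above; this sum is a crude bound on all
   moduli. *)
exists (\sum_k `|d 0 k|) => _ [z /(spectrum_diag uP defA)[k ->] <-].
by rewrite mxE cmod_real (bigD1 k) //= lerDl sumr_ge0.
Qed.

Lemma exists_ge_mean (R : realType) n (d : 'I_n -> R) (j0 : 'I_n) :
  (1 < n)%N -> \sum_j d j = 0 ->
  exists2 j, j != j0 & - d j0 / (n%:R - 1) <= d j.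
Proof.
case: n d j0 => [//|[//|n]] d j0 _ sum0.
have n0 : n.+2%:R - 1 = n.+1%:R :> R by rewrite -natr1 addrK.
apply: contrapT => H.
have : \sum_(j | j != j0) d j < \sum_(j | j != j0) (- d j0 / (n.+2%:R - 1)).
  apply: ltr_sum.
    (* Strictness of the summed inequality requires an index other than [j0], available since there
       are at least two. *)
    by apply/hasP; exists (lift j0 ord0); rewrite ?mem_index_enum // eq_sym neq_lift.
  by move=> j jj0; rewrite ltNge; apply/negP => le; apply: H; exists j.
rewrite sumr_const cardC1 card_ord /= n0 -[X in _ < X]mulr_natr divfK ?pnatr_eq0 //.
have := sum0; rewrite (bigD1 j0) //= => /eqP; rewrite addrC addr_eq0 => /eqP->.
by rewrite ltxx.
Qed.

Theorem proposition7 (R : realType) (n : nat) (hn : (2 <= n)%N)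
    (A : 'M[R]_n) (hA : adjacency_mx A)
    (rho : R) (hrho : rho = perron_value A)
    (u : 'cV[R]_n) (hu : perron_vector A u) :
  (n%:R - 1) / (n%:R * rho) <= eigenvector_cond (complex_mx A) (complex_mx u).
Proof.
case: hu => Au _ u_gt0; rewrite -hrho in Au.
have [symA A_ge0 diagA irrA] := hA.
have [P [d uP defA]] := symmetric_mx_diag symA.
have i0 : 'I_n by exact: Ordinal (ltnW hn).
have cAu : complex_mx A *m complex_mx u = rho%:C *: complex_mx u.
  by rewrite -[LHS]map_mxM Au map_mxZ.
have -> : eigenvector_cond (complex_mx A) (complex_mx u) =
    (eigenvalue_gap (complex_mx A) rho%:C)^-1.
  (* A nonzero entry of [u] pins down the eigenvalue chosen by [xget] as [rho]. *)
  congr (eigenvalue_gap _ _)^-1; apply: xget_unique => // z /= zu.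
  have /colP/(_ i0) : rho%:C *: complex_mx u = z *: complex_mx u by rewrite -cAu.
  rewrite !mxE => /esym; apply: mulIf.
  by rewrite (inj_eq (@complexI R)) gt_eqF.
have spec := spectrum_diag uP defA.
have simple := perron_value_simple irrA A_ge0 symA Au u_gt0 uP defA.
have [j0 dj0] : exists j0, d 0 j0 = rho.
  suff /spec[j] : spectrum (complex_mx A) rho%:C by rewrite mxE => -[->]; exists j.
  apply/eigenvalueP; exists (complex_mx u)^T.
    by rewrite -[X in _ *m X]trmxK -trmx_mul /complex_mx map_trmx symA cAu linearZ.
  apply/eqP => /rowP/(_ i0)/eqP; rewrite !mxE.
  by rewrite (inj_eq (@complexI R)) gt_eqF.
have sumd : \sum_j d 0 j = 0.
  apply: (@complexI R); rewrite rmorph_sum /=.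
  (* The trace is invariant under conjugation by [P]. *)
  have -> : \sum_j (d 0 j)%:C = \tr (complex_mx A).
    rewrite defA mxtrace_mulC mulmxA mulmxV // mul1mx mxtrace_diag.
    by apply: eq_bigr => j _; rewrite mxE.
  by rewrite /mxtrace big1 // => j _; rewrite mxE diagA.
have [j1 j10 ge1] := exists_ge_mean j0 hn sumd; rewrite dj0 in ge1.
have le1 := real_eigenvalue_le_perron uP defA j1; rewrite -hrho in le1.
pose G := [set cmod (rho%:C - g) | g in
  [set g | spectrum (complex_mx A) g /\ g <> rho%:C]]%classic.
have G1 : G (rho - d 0 j1).
  exists (d 0 j1)%:C.
    split; first by apply/spec; exists j1; rewrite mxE.
    (* Simplicity of [rho] gives [d 0 j1 <> rho], since [j1 != j0]. *)
    by case=> dj1; move: j10; rewrite (simple j1 j0) ?eqxx.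
  by rewrite -rmorphB cmod_real ger0_norm // subr_ge0.
have gap_le : eigenvalue_gap (complex_mx A) rho%:C <= rho - d 0 j1.
  apply: ge_inf => //; exists 0 => _ [g _ <-].
  by rewrite /cmod normc_def sqrtr_ge0.
(* Needed because 0^-1 = 0. *)
have gap_gt0 : 0 < eigenvalue_gap (complex_mx A) rho%:C.
  (* An explicit positive lower bound for the distances from [rho] to the other eigenvalues; the
     default 1 keeps it positive. *)
  pose m := \big[Order.min/1]_(j | d 0 j != rho) `|rho - d 0 j|.
  apply: (@lt_le_trans _ _ m).
    by apply: lt_bigmin => // j dj; rewrite normr_gt0 subr_eq0 eq_sym.
  apply: lb_le_inf; first by exists (rho - d 0 j1).
  move=> _ [g [/spec[j ->] gr] <-]; rewrite mxE -rmorphB cmod_real.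
  apply: bigmin_le_cond; apply/eqP => djr; apply: gr.
  by rewrite mxE djr.
have n1 : 0 < n%:R - 1 :> R by rewrite subr_gt0 ltr1n.
have n_gt0 : 0 < n%:R :> R by rewrite ltr0n ltnW.
have gap_bound : eigenvalue_gap (complex_mx A) rho%:C <= n%:R * rho / (n%:R - 1).
  (* After rearrangement, [rho - n rho / (n - 1) = - rho / (n - 1)] is the lower bound on
     [d 0 j1]. *)
  rewrite (le_trans gap_le) // lerBlDr -lerBlDl (le_trans _ ge1) // le_eqVlt.
  by apply/orP; left; apply/eqP; field; rewrite gt_eqF.
rewrite -[X in X <= _]invrK invf_div lef_pV2 // posrE.
exact: lt_le_trans gap_bound.
Qed.
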